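(* Let $\overline{C}(\zeta;q)$ be the first residual crank generating function for overpartitions, and for each integer $s\ge1$ let $\overline{\mathcal{C}}_{2s}(q)$ denote its normalized $2s$-th moment generating function. Then for every positive integer $s$, $$\overline{\mathcal{C}}_{2s}(q)=\operatorname{Tr}_s\Big(\Psi_T;\ G_2+\frac{B_2}{4},\ G_4+\frac{B_4}{8},\ \ldots,\ G_{2s}+\frac{B_{2s}}{4s}\Big)$$ and $$G_{2s}=-\frac{B_{2s}}{4s}+\operatorname{Tr}_s\Big(\Psi_V;\ \overline{\mathcal{C}}_2(q),\ \overline{\mathcal{C}}_4(q),\ \ldots,\ \overline{\mathcal{C}}_{2s}(q)\Big).$$
   Context: Here $q=e^{2\pi i\tau}$ with $\operatorname{Im}\tau>0$ (so $|q|<1$), $(a;q)_\infty=\prod_{n\ge0}(1-aq^n)$, and $B_k$ denotes the $k$-th Bernoulli number. The first residual crank of an overpartition is the crank of the subpartition formed by its non-overlined parts. Its generating function is (and is taken to be) $$\overline{C}(\zeta;q)=\sum_{n\ge0}\sum_{m\in\mathbb{Z}}\overline{M}(m;n)\zeta^mq^n=\frac{(q^2;q^2)_\infty}{(\zeta q;q)_\infty(q/\zeta;q)_\infty}.$$ Normalized moments. For $r\ge0$, $$\overline{\mathcal{C}}_r(q)=\frac{1}{\overline{C}(1;q)}\sum_{n\ge0}\sum_{m\in\mathbb{Z}}m^r\,\overline{M}(m;n)q^n=\frac{1}{\overline{C}(1;q)}\left.\Big(\zeta\frac{\partial}{\partial\zeta}\Big)^{r}\overline{C}(\zeta;q)\right|_{\zeta=1}.$$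 Eisenstein series. For $k\ge1$, $G_{2k}=G_{2k}(\tau)=-\frac{B_{2k}}{4k}+\sum_{n\ge1}\sigma_{2k-1}(n)q^n$, where $\sigma_{j}(n)=\sum_{d\mid n}d^{j}$. Partition traces. A partition $\beta$ of $s$ is written $\beta=(1^{m_1},2^{m_2},\ldots,s^{m_s})\vdash s$, where $m_k\ge0$ is the multiplicity of the part $k$ (so $\sum_k k\,m_k=s$), and $\ell(\beta)=m_1+\cdots+m_s$. For a function $\Psi$ on partitions and quantities $F_1,\ldots,F_s$, $$\operatorname{Tr}_s(\Psi;F_1,\ldots,F_s)=\sum_{\beta\vdash s}\Psi(\beta)\prod_{k=1}^sF_k^{m_k}.$$ For $\beta=(1^{m_1},\ldots,s^{m_s})\vdash s$, $$\Psi_T(\beta)=(2s)!\prod_{k=1}^s\frac{2^{m_k}}{m_k!\,((2k)!)^{m_k}},\qquad \Psi_V(\beta)=\frac{(2s)!}{2}(-1)^{\ell(\beta)-1}(\ell(\beta)-1)!\prod_{k=1}^s\frac{1}{m_k!\,((2k)!)^{m_k}}.$$ *)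

(* Defs.v *)
From HB Require Import structures.
From mathcomp Require Import all_boot all_order all_algebra.
From mathcomp Require Import all_classical all_reals all_analysis.
From mathcomp Require Import complex.

Set Implicit Arguments.
Unset Strict Implicit.
Unset Printing Implicit Defensive.

Import Order.TTheory GRing.Theory Num.Theory.
Import numFieldNormedType.Exports.

Local Open Scope ring_scope.
Local Open Scope complex_scope.

(* Bernoulli numbers, t / (e^t - 1) = \sum_n B_n t^n / n!, so B_1 = -1/2:
   B_n is obtained from B_0, ..., B_(n-1) by solving the recurrence
   [bernoulli_rec] below.  [bernoulli_seq n] is [:: B_0; ...; B_(n-1)]. *)
Fixpoint bernoulli_seq (n : nat) : seq rat :=
  if n is n'.+1 then
    let B := bernoulli_seq n' in
    rcons B (((n' == 0)%N%:R - \sum_(j < n') 'C(n'.+1, j)%:R * B`_j)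
               / n'.+1%:R)
  else [::].

Definition bernoulli (n : nat) : rat := (bernoulli_seq n.+1)`_n.

Lemma size_bernoulli_seq (n : nat) : size (bernoulli_seq n) = n.
Proof. by elim: n => //= n IHn; rewrite size_rcons IHn. Qed.

Lemma nth_bernoulli_seq (n j : nat) :
  (j < n)%N -> (bernoulli_seq n)`_j = bernoulli j.
Proof.
elim: n => // n IHn; rewrite ltnS leq_eqVlt => /orP[/eqP -> //|jn].
by rewrite -IHn //= nth_rcons size_bernoulli_seq jn.
Qed.

Lemma bernoulli_rec (n : nat) :
  \sum_(j < n.+1) 'C(n.+1, j)%:R * bernoulli j = (n == 0)%N%:R.
Proof.
rewrite big_ord_recr /= [X in _ + _ * X]/bernoulli /=.
rewrite nth_rcons size_bernoulli_seq ltnn eqxx binSn mulrC divfK ?pnatr_eq0 //.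
rewrite [X in _ + (_ - X)](eq_bigr (fun j : 'I_n =>
  'C(n.+1, j)%:R * bernoulli j)); first by rewrite addrC subrK.
by move=> j _; rewrite nth_bernoulli_seq.
Qed.

Definition sigma (j n : nat) : nat := (\sum_(d <- divisors n) d ^ j)%N.

(* The definitions over an arbitrary numFieldType K are meant for K = R[i];
   limits and derivatives are those of the topology given by the norm. *)

(* (a; q)_oo *)
Definition qpoch (K : numFieldType) (a q : K) : K :=
  \big[*%R/1]_(0 <= n <oo) (1 - a * q ^+ n).

Definition residual_crank (K : numFieldType) (zeta q : K) : K :=
  qpoch (q ^+ 2) (q ^+ 2) / (qpoch (zeta * q) q * qpoch (q / zeta) q).

(* The operator zeta * d/dzeta. *)
Definition zeta_derive (K : numFieldType) (f : K -> K) : K -> K :=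
  fun zeta => zeta * derive1 f zeta.

Definition crank_moment (K : numFieldType) (r : nat) (q : K) : K :=
  iter r (@zeta_derive K) (fun zeta => residual_crank zeta q) 1
    / residual_crank 1 q.

(* [eisenstein k q] is G_(2k), of weight 2k. *)
Definition eisenstein (K : numFieldType) (k : nat) (q : K) : K :=
  - (ratr (bernoulli (2 * k)) / (4 * k)%:R)
  + \big[+%R/0]_(1 <= n <oo) ((sigma (2 * k).-1 n)%:R * q ^+ n).

(* A partition of s is encoded by its multiplicities, all at most s:
   [m i] is the multiplicity of the part i.+1, for i < s. *)
Definition multiplicities (s : nat) := {ffun 'I_s -> 'I_s.+1}.

Definition is_partition (s : nat) (m : multiplicities s) : bool :=
  (\sum_(i < s) i.+1 * m i == s)%N.

Definition part_length (s : nat) (m : multiplicities s) : nat :=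
  (\sum_(i < s) m i)%N.

Definition part_trace (K : fieldType) (s : nat)
    (Psi : multiplicities s -> K) (F : nat -> K) : K :=
  \sum_(m : multiplicities s | is_partition m)
     Psi m * \prod_(i < s) F i.+1 ^+ m i.

Definition PsiT (K : fieldType) (s : nat) (m : multiplicities s) : K :=
  (2 * s)`!%:R *
  \prod_(i < s) (2 ^+ m i / ((m i)`!%:R * (2 * i.+1)`!%:R ^+ m i)).

Definition PsiV (K : fieldType) (s : nat) (m : multiplicities s) : K :=
  (2 * s)`!%:R / 2 * (-1) ^+ (part_length m).-1
    * ((part_length m).-1)`!%:R *
  \prod_(i < s) ((m i)`!%:R * (2 * i.+1)`!%:R ^+ m i)^-1.

Definition cexp (R : realType) (z : R[i]) : R[i] :=
  (expR (complex.Re z))%:C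
    * (cos (complex.Im z) +i* sin (complex.Im z)).

(* q = e^(2 pi i tau) *)
Definition nome (R : realType) (tau : R[i]) : R[i] :=
  cexp (2 * (pi : R)%:C * (0 +i* 1) * tau).

(* Main.v *)
Require Import Defs.
From mathcomp Require Import all_boot all_order all_algebra.
From mathcomp Require Import all_classical all_reals all_analysis.
From mathcomp Require Import complex ring.
Import Order.TTheory GRing.Theory Num.Theory.
Import numFieldNormedType.Exports.
Local Open Scope ring_scope.
Local Open Scope complex_scope.

(* Euler's power series B(z) = sum_k b_k z^k, b_k = prod_(i=1)^k q/(1-q^i),
   satisfies B(zq) = (1-zq) B(z), so B(z) times the partial products of
   (zq;q)_oo is B(z q^N) -> 1 and B(z) = 1/(zq;q)_oo.  Hence the residual crank
   is c B(z) B(1/z).  The Lambert series P(z) = sum_k q^k/(1-q^k) z^k is the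
   logarithmic derivative z B'/B, by the same kind of q-invariance.  Leibniz'
   rule for powers of z d/dz at z = 1 then gives, for the moments a_r,
   a_(r+1) = sum_j C(r,j) a_j l_(r-j), where l_i is 0 for i even and twice
   sum_n sigma_i(n) q^n for i odd.  With u_k = a_(2k)/(2k)! and x_k =
   l_(2k-1)/(2k)! this says sum_k u_k X^k = exp (sum_k x_k X^k), and the two
   partition traces are the coefficients of this exponential and of the
   inverse logarithm, by the multinomial formula. *)

(** * Partition traces as coefficients of exponentials and logarithms *)

Section PartitionTraces.
Variable K : numFieldType.

(** In an auxiliary outer variable T, the series exp (v_i T) multiply to exp ((sum v_i) T);
    truncating each factor after T^N keeps the coefficients up to T^N. *)
Lemma coef_prod_truncated_exp (I : Type) (r : seq I) (v : I -> {poly K})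
    (N n : nat) : (n <= N)%N ->
  (\prod_(i <- r) \poly_(m < N.+1) ((m`!%:R : K)^-1 *: v i ^+ m))`_n
    = (n`!%:R : K)^-1 *: (\sum_(i <- r) v i) ^+ n.
Proof.
elim: r n => [|i r IHr] n nN.
  rewrite !big_nil coef1 expr0n; case: n nN => [|n] _ /=.
    by rewrite fact0 invr1 scale1r.
  by rewrite scaler0.
rewrite !big_cons coefM addrC exprDn scaler_sumr; apply: eq_bigr => j _.
have jn : (j <= n)%N by rewrite -ltnS.
rewrite coef_poly ltnS (leq_trans jn nN) IHr ?(leq_trans (leq_subr _ _) nN) //.
rewrite -scalerAl -scalerAr scalerA mulrC [_ * v i ^+ j]mulrC.
rewrite -[_ *+ 'C(n, j)]scaler_nat scalerA; congr (_ *: _).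
rewrite -(bin_fact jn) !natrM; field.
by rewrite !pnatr_eq0 -!lt0n bin_gt0 jn !fact_gt0.
Qed.

Lemma multinomial (s N n : nat) (v : 'I_s -> {poly K}) : (n <= N)%N ->
  \sum_(m : {ffun 'I_s -> 'I_N.+1} | (\sum_i m i == n)%N)
     \prod_i (((m i)`!%:R : K)^-1 *: v i ^+ m i)
    = (n`!%:R : K)^-1 *: (\sum_i v i) ^+ n.
Proof.
move=> nN; rewrite -(coef_prod_truncated_exp _ _ _ _ _ nN).
under [in RHS]eq_bigr do rewrite poly_def.
rewrite (bigA_distr_bigA (fun i (m : 'I_N.+1) => _ *: 'X^m)) coef_sum.
rewrite big_mkcond; apply: eq_bigr => m _.
under [in RHS]eq_bigr do rewrite -mul_polyC.
rewrite big_split /= -rmorph_prod -expr_sum coefCM coefXn eq_sym.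
by case: eqP => _; rewrite ?mulr1 ?mulr0.
Qed.

Definition part_series (s : nat) (F : nat -> K) : {poly K} :=
  \sum_(i < s) F i.+1 *: 'X^(i.+1).

Lemma coef_part_series (s : nat) (F : nat -> K) (n : nat) :
  (part_series s F)`_n = if (0 < n <= s)%N then F n else 0.
Proof.
rewrite /part_series coef_sum.
under eq_bigr do rewrite coefZ coefXn.
case: n => [|n] /=; first by rewrite big1 // => i _; rewrite mulr0.
case: ltnP => [ns|sn]; last first.
  rewrite big1 // => i _; rewrite eqSS gtn_eqF ?mulr0 //.
  exact: leq_trans (ltn_ord i) sn.
rewrite (bigD1 (Ordinal ns)) //= eqxx mulr1 big1 ?addr0 // => i.
rewrite -val_eqE /= => /negPf; rewrite eqSS eq_sym => ->; exact: mulr0.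
Qed.

Lemma part_length_le (s : nat) (m : multiplicities s) :
  is_partition m -> (part_length m <= s)%N.
Proof.
move=> /eqP {2}<-; apply: leq_sum => i _; exact: leq_pmull.
Qed.

(** Grouping by length [n]: among all multiplicities with sum [n], the coefficient of X^s in the
    multinomial formula selects the partitions of [s]. The weight [g] is 1 for the exponential and
    (-1)^(n-1) (n-1)! for the logarithm. *)
Lemma sum_partitions_coef (s : nat) (g F : nat -> K) :
  \sum_(m : multiplicities s | is_partition m)
     g (part_length m) * \prod_(i < s) (((m i)`!%:R)^-1 * F i.+1 ^+ m i)
  = \sum_(n < s.+1) g n / n`!%:R * (part_series s F ^+ n)`_s.
Proof.
transitivity (\sum_(n < s.+1) \sum_(m : multiplicities s | part_length m == n)
   g n * (\prod_i ((((m i)`!%:R : K)^-1 *: (F i.+1 *: 'X^(i.+1)) ^+ m i)))`_s).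
  under [RHS]eq_bigr do rewrite big_mkcond.
  rewrite exchange_big /= [LHS]big_mkcond; apply: eq_bigr => m _.
  have -> : \prod_i (((m i)`!%:R : K)^-1 *: (F i.+1 *: 'X^(i.+1)) ^+ m i)
     = (\prod_(i < s) (((m i)`!%:R)^-1 * F i.+1 ^+ m i)) *:
       'X^(\sum_(i < s) i.+1 * m i).
    rewrite expr_sum -mul_polyC rmorph_prod -big_split /=.
    by apply: eq_bigr => i _; rewrite exprZn -exprM scalerA mul_polyC.
  under [RHS]eq_bigr do rewrite coefZ coefXn.
  rewrite eq_sym -/(is_partition m).
  case: ifP => pm; last by rewrite big1 // => n _; rewrite !mulr0; case: ifP.
  rewrite (bigD1 (Ordinal (part_length_le _ _ pm : (_ < s.+1)%N))) //= eqxx mulr1.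
  rewrite [X in _ + X]big1 ?addr0 // => n.
  by rewrite -val_eqE /= eq_sym => /negPf ->.
apply: eq_bigr => n _; rewrite -mulr_sumr -coef_sum -mulrA; congr (_ * _).
by rewrite multinomial ?coefZ // -ltnS.
Qed.

(** [part_series] has no constant term, so its [s]-th power is divisible by X^s; this removes the
    truncation errors below. *)
Lemma coef_mul_part_series_expn (s n : nat) (p : {poly K}) (F : nat -> K) :
  (n < s)%N -> (p * part_series s F ^+ s)`_n = 0.
Proof.
move=> ns; have -> : part_series s F = (\sum_(i < s) F i.+1 *: 'X^i) * 'X.
  by rewrite mulr_suml; apply: eq_bigr => i _; rewrite -scalerAl -exprSr.
by rewrite exprMn mulrA coefMXn ns.
Qed.

Lemma coef_deriv_part_series (s n : nat) (F : nat -> K) :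
  (n < s)%N -> ((part_series s F)^`())`_n = n.+1%:R * F n.+1.
Proof. by move=> ns; rewrite coef_deriv coef_part_series /= ns mulr_natl. Qed.

(** * Exponential and logarithm of power series through their differential equations *)

Section ExpLog.
Variables x u : nat -> K.
Hypothesis u0 : u 0%N = 1.
(* In terms of generating functions, [u = exp x]. *)
Hypothesis u_rec : forall n,
  n.+1%:R * u n.+1 = \sum_(k < n.+1) k.+1%:R * x k.+1 * u (n - k)%N.

(** The truncated exponential [W] satisfies W' = V' W up to a multiple of V^s, invisible below X^s;
    on coefficients this is the recurrence [u_rec]. *)
Lemma exp_part_series (s n : nat) : (n <= s)%N ->
  (\sum_(j < s.+1) (j`!%:R)^-1 *: part_series s x ^+ j)`_n = u n.
Proof.
set V := part_series s x; set W := \sum_(j < s.+1) _.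
have dW : W^`() = V^`() * (W - (s`!%:R)^-1 *: V ^+ s).
  rewrite /W [in RHS]big_ord_recr /= addrK raddf_sum /=.
  rewrite big_ord_recl /= expr0 derivZ derivC scaler0 add0r mulr_sumr.
  apply: eq_bigr => j _; rewrite derivZ /bump /= add1n deriv_exp /=.
  rewrite -[X in _ *: X]scaler_nat scalerA -scalerAr factS natrM invfM mulrAC mulVf ?mul1r //.
elim/ltn_ind: n => -[|n] IHn ns.
  rewrite u0 /W coef_sum big_ord_recl /= fact0 invr1 scale1r expr0 coef1.
  rewrite big1 ?addr0 // => j _; rewrite coefZ /bump /= add1n.
  by rewrite exprS coefM big_ord1 /= /V coef_part_series mul0r mulr0.
have nz : (n.+1%:R : K) != 0 by rewrite pnatr_eq0.
apply: (mulfI nz); rewrite u_rec mulr_natl -coef_deriv dW mulrBr coefB.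
rewrite -scalerAr coefZ coef_mul_part_series_expn // mulr0 subr0 coefM.
apply: eq_bigr => k _; rewrite coef_deriv_part_series ?IHn //.
- by rewrite ltnS leq_subr.
- exact: leq_trans (leq_subr _ _) (ltnW ns).
- exact: leq_trans (ltn_ord k) ns.
Qed.

(** The truncated logarithm [L] of 1 + V satisfies (1 + V) L' = V' up to a multiple of V^s, which is
    [u_rec] solved for [x]. The term [j = 0] is the constant 1 and affects no coefficient of
    positive degree. *)
Lemma log_part_series (s n : nat) : (n < s)%N ->
  (\sum_(j < s.+1) ((-1) ^+ j.-1 * j.-1`!%:R / j`!%:R) *:
     part_series s u ^+ j)`_n.+1 = x n.+1.
Proof.
set V := part_series s u; set L := \sum_(j < s.+1) _.
have dL : (1 + V) * L^`() = V^`() - (V^`() * V ^+ s) * (-1) ^+ s.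
  (* For j > 0 the coefficient is (-1)^(j-1) / j, so derivation yields a finite geometric sum in
     -V. *)
  have -> : L^`() = V^`() * \sum_(j < s) (- V) ^+ j.
    rewrite /L raddf_sum /= big_ord_recl /= expr0 derivZ derivC scaler0 add0r.
    rewrite mulr_sumr; apply: eq_bigr => j _.
    rewrite derivZ /bump /= add1n add0n deriv_exp /= -[X in _ *: X]scaler_nat.
    rewrite scalerA -[- V]mulN1r exprMn -polyC1 -polyCN -polyC_exp mul_polyC.
    rewrite -scalerAr; congr (_ *: _); rewrite factS natrM; field.
    by rewrite nat1r pnatr_eq0 pnatr_eq0 -lt0n fact_gt0.
  have := subrX1 (- V) s; rewrite -[- V]mulN1r exprMn; move: (\sum_(i < s) _).
  move=> S eS; have -> : (1 + V) * (V^`() * S) = - V^`() * ((-1 * V - 1) * S).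
    by ring.
  by rewrite -eS; ring.
have cV k : (k <= s)%N -> (1 + V)`_k = u k.
  rewrite coefD coef1 coef_part_series; case: k => [|k] ks /=.
    by rewrite addr0 u0.
  by rewrite ks add0r.
have nz k : (k.+1%:R : K) != 0 by rewrite pnatr_eq0.
elim/ltn_ind: n => n IHn ns; apply: (mulfI (nz n)).
rewrite [LHS]mulr_natl -coef_deriv.
have := congr1 (fun p : {poly K} => p`_n) dL.
rewrite coefB -polyC1 -polyCN -polyC_exp coefMC coef_mul_part_series_expn //.
rewrite mul0r subr0 coef_deriv_part_series // u_rec polyC1 mulrC coefM.
rewrite !big_ord_recr /= subnn cV // u0 !mulr1.
(* Apart from the last term, which holds the coefficient sought, both sums agree by induction. *)
have -> : \sum_(k < n) L^`()`_k * (1 + V)`_(n - k)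
        = \sum_(k < n) k.+1%:R * x k.+1 * u (n - k)%N.
  apply: eq_bigr => k _; rewrite cV ?(leq_trans (leq_subr _ _) (ltnW ns)) //.
  by rewrite coef_deriv IHn ?mulr_natl // (ltn_trans (ltn_ord k) ns).
exact: addrI.
Qed.

End ExpLog.

(** * From the moment recurrence to the two trace formulas *)

Section MomentTraces.
(** To be applied with [a k] the moment of order 2k and [e k] the sum of sigma_(2k-1)(n) q^n. *)
Variables a e : nat -> K.
Hypothesis a0 : a 0%N = 1.
Hypothesis a_rec : forall n, a n.+1 =
  \sum_(k < n.+1) 'C(n.*2.+1, k.*2.+1)%:R * (2 * e k.+1) * a (n - k)%N.

Let u k := a k / (2 * k)`!%:R.
(** The 2 here accounts for the powers of 2 in [PsiT] and for the 1/2 in [PsiV]. *)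
Let x k := 2 * e k / (2 * k)`!%:R.

Let fact_neq0 k : (k`!%:R : K) != 0.
Proof. by rewrite pnatr_eq0 -lt0n fact_gt0. Qed.

Let u0 : u 0%N = 1.
Proof. by rewrite /u a0 muln0 fact0 divr1. Qed.

(** Since C(2n+1, 2k+1) = (2n+1)! / ((2k+1)! (2n-2k)!) and (2m+2)! = 2 (m+1) (2m+1)!, dividing
    [a_rec] by (2n+2)! produces the factors n+1 and k+1. *)
Let u_rec n :
  n.+1%:R * u n.+1 = \sum_(k < n.+1) k.+1%:R * x k.+1 * u (n - k)%N.
Proof.
rewrite /u a_rec mulr_suml mulr_sumr; apply: eq_bigr => k _.
have kn : (k <= n)%N by rewrite -ltnS.
have kn2 : (k.*2.+1 <= n.*2.+1)%N by rewrite ltnS leq_double.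
have factE m : (2 * m.+1)`!%:R = 2 * m.+1%:R * (m.*2.+1)`!%:R :> K.
  by rewrite -!natrM mul2n doubleS factS.
have bin_factE : (n.*2.+1)`!%:R =
    'C(n.*2.+1, k.*2.+1)%:R * ((k.*2.+1)`!%:R * (2 * (n - k))`!%:R) :> K.
  by rewrite -!natrM -(bin_fact kn2) subSS -doubleB mul2n.
rewrite /x !factE bin_factE; field.
by rewrite !nat1r !fact_neq0 !pnatr_eq0 -?lt0n bin_gt0 kn2.
Qed.

Lemma part_trace_PsiT (s : nat) : (0 < s)%N -> a s = part_trace (@PsiT K s) e.
Proof.
move=> s_gt0; rewrite /part_trace.
transitivity ((2 * s)`!%:R * \sum_(m : multiplicities s | is_partition m)
    1 * \prod_(i < s) (((m i)`!%:R)^-1 * x i.+1 ^+ m i)).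
  rewrite (sum_partitions_coef _ (fun=> 1)).
  under eq_bigr do rewrite mul1r -coefZ.
  rewrite -coef_sum (exp_part_series _ _ u0 u_rec _ _ (leqnn s)) // /u mulrC divfK //.
rewrite mulr_sumr; apply: eq_bigr => m _; rewrite /PsiT -mulrA mul1r.
congr (_ * _); rewrite -big_split; apply: eq_bigr => i _ /=.
rewrite /x !exprMn exprVn invfM.
move: (2 ^+ m i) (e i.+1 ^+ m i) => t w; ring.
Qed.

Lemma part_trace_PsiV (s : nat) : (0 < s)%N -> e s = part_trace (@PsiV K s) a.
Proof.
move=> s_gt0; rewrite /part_trace.
transitivity ((2 * s)`!%:R / 2 * \sum_(m : multiplicities s | is_partition m)
    ((-1) ^+ (part_length m).-1 * (part_length m).-1`!%:R)
     * \prod_(i < s) (((m i)`!%:R)^-1 * u i.+1 ^+ m i)).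
  rewrite (sum_partitions_coef _ (fun n => (-1) ^+ n.-1 * n.-1`!%:R)).
  under eq_bigr do rewrite -coefZ.
  case: s s_gt0 => // s _; rewrite -coef_sum (log_part_series _ _ u0 u_rec) //.
  by rewrite /x; field; rewrite fact_neq0.
rewrite mulr_sumr; apply: eq_bigr => m _; rewrite /PsiV -!mulrA.
do 4 congr (_ * _).
rewrite -big_split; apply: eq_bigr => i _ /=.
rewrite /u exprMn exprVn invfM; move: (a i.+1 ^+ m i) => t; ring.
Qed.

End MomentTraces.
End PartitionTraces.

(** * Absolutely convergent power series *)

Section AbsoluteSeries.
Variable K : numFieldType.
Implicit Types (u v a : nat -> K) (z r x : K).

Definition abs_bounded u :=
  exists M, forall n, \sum_(0 <= k < n) `|u k| <= M.

(** The form of completeness on which the analysis rests; [complex_abs_complete] provides it for the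
    complex numbers. *)
Definition abs_complete := forall u, abs_bounded u -> cvgn (series u).

Definition ssum u : K := limn (series u).

Lemma cvgn_norm_le u l (M : K) :
  (u @ \oo --> l)%classic -> (forall n, `|u n| <= M) -> `|l| <= M.
Proof.
(* The order of [K] is only partial: negating |l| <= M into M < |l| requires [M] to be real. *)
move=> ul uM; have M_real : M \is Num.real.
  exact: ger0_real (le_trans (normr_ge0 (u 0%N)) (uM 0%N)).
rewrite real_leNgt ?normr_real //; apply/negP => Ml.
have e_gt0 : 0 < `|l| - M by rewrite subr_gt0.
have /cvgrPdist_lt /(_ _ e_gt0) [N _ /(_ N (leqnn N)) /= ltN] := ul.
have : `|l| < `|l| - M + M.
  rewrite -[X in `|X| < _](subrK (u N)); apply: le_lt_trans (ler_normD _ _) _.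
  exact: ltr_leD.
by rewrite subrK ltxx.
Qed.

Lemma sum_geometric_le (t : K) n :
  0 <= t -> t < 1 -> \sum_(0 <= k < n) t ^+ k <= (1 - t)^-1.
Proof.
move=> t0 t1; have t1' : 0 < 1 - t by rewrite subr_gt0.
rewrite -[X in _ <= X]mul1r ler_pdivlMr // big_mkord mulrC -opprB mulNr -subrX1.
by rewrite opprB gerBl exprn_ge0.
Qed.

Lemma eq_cvg_series u v (l : K) : u =1 v ->
  (series u @ \oo --> l)%classic -> (series v @ \oo --> l)%classic.
Proof. by move=> /funext ->. Qed.

Lemma cvg_seriesD u v (l m : K) :
  (series u @ \oo --> l)%classic -> (series v @ \oo --> m)%classic ->
  (series (fun k => u k + v k) @ \oo --> l + m)%classic.
Proof.
move=> ul vm; have -> : series (fun k => u k + v k) = series u \+ series v.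
  by apply/funext => n; rewrite /series /= big_split.
exact: cvgD.
Qed.

Lemma cvg_seriesZ u (c l : K) :
  (series u @ \oo --> l)%classic ->
  (series (fun k => c * u k) @ \oo --> c * l)%classic.
Proof.
move=> ul; have -> : series (fun k => c * u k) = (fun n => c * series u n).
  by apply/funext => n; rewrite /series /= mulr_sumr.
by apply: cvgM => //; exact: cvg_cst.
Qed.

Lemma cvg_series_recl u (l : K) :
  (series (fun k => u k.+1) @ \oo --> l)%classic ->
  (series u @ \oo --> u 0%N + l)%classic.
Proof.
move=> ul; rewrite -cvg_shiftS /=.
have -> : (fun n => series u n.+1) = (fun n => u 0%N + series (fun k => u k.+1) n).
  by apply/funext => n; rewrite /series /= big_nat_recl.
by apply: cvgD => //; exact: cvg_cst.
Qed.

Lemma ssum_cvg u (l : K) : (series u @ \oo --> l)%classic -> ssum u = l.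
Proof. by move=> ul; apply: cvg_lim => //; exact: norm_hausdorff. Qed.

Hypothesis Kc : abs_complete.

Lemma cvg_ssum u : abs_bounded u -> (series u @ \oo --> ssum u)%classic.
Proof. by move=> /Kc. Qed.

Lemma norm_ssum_le u (M : K) :
  (forall n, \sum_(0 <= k < n) `|u k| <= M) -> `|ssum u| <= M.
Proof.
move=> uM; have ub : abs_bounded u by exists M.
apply: (cvgn_norm_le _ _ _ (cvg_ssum _ ub)) => n.
exact: le_trans (ler_norm_sum _ _ _) (uM n).
Qed.

Lemma cvg_expn_0 (t : K) : `|t| < 1 -> ((fun n => t ^+ n) @ \oo --> (0 : K))%classic.
Proof.
move=> t1; apply: cvg_series_cvg_0; apply: Kc.
exists (1 - `|t|)^-1 => n; under eq_bigr do rewrite normrX.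
exact: sum_geometric_le.
Qed.

End AbsoluteSeries.
Arguments ssum {K}.
Arguments abs_bounded {K}.

(** * Derivatives from a quadratic error bound, and the chain rule *)

Section Derivative.
Variable K : numFieldType.

Lemma is_derive_quadratic (f : K -> K) (z l C d : K) : 0 < d -> 0 <= C ->
  (forall h, `|h| <= d -> `|f (z + h) - f z - h * l| <= C * `|h| ^+ 2) ->
  is_derive z 1 f l.
Proof.
move=> d_gt0 C_ge0 fq.
have cv : ((fun h => h^-1 *: ((f \o shift z) (h *: 1) - f z)) @ 0^' --> l)%classic.
  apply/cvgrPdistC_lt => e e_gt0.
  (* The quotient error is at most C |h|; dividing by C + 1 avoids the case C = 0. *)
  have C1 : 0 < C + 1 by exact: ltr_wpDl.
  near=> h; have h0 : h != 0 by near: h; exact: nbhs_dnbhs_neq.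
  have hd : `|h| <= d by near: h; exact: dnbhs0_le.
  have he : `|h| < e / (C + 1) by near: h; apply: dnbhs0_lt; exact: divr_gt0.
  have -> : h^-1 *: ((f \o shift z) (h *: 1) - f z) - l
      = h^-1 * (f (z + h) - f z - h * l).
    have /= -> : h *: (1 : K) = h by exact: mulr1.
    by rewrite [z + h]addrC -[h^-1 *: _]/(h^-1 * _) [RHS]mulrBr mulKf.
  rewrite normrM normfV ltr_pdivrMl ?normr_gt0 //.
  apply: le_lt_trans (fq h hd) _; rewrite expr2 mulrCA ltr_pM2l ?normr_gt0 //.
  rewrite ltr_pdivlMr // mulrDr mulr1 mulrC in he.
  by apply: le_lt_trans he; rewrite lerDl.
by apply: DeriveDef; [apply: cvgP cv | apply: cvg_lim cv; exact: norm_hausdorff].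
Unshelve. all: by end_near. Qed.

Lemma is_derive_chain (f g : K -> K) (z df dg : K) :
  is_derive z 1 f df -> is_derive (f z) 1 g dg ->
  is_derive z 1 (fun w => g (f w)) (dg * df).
Proof.
move=> fdf gdg.
have /derivable1_diffP Df := @ex_derive _ _ _ _ _ _ _ fdf.
have /derivable1_diffP Dg := @ex_derive _ _ _ _ _ _ _ gdg.
have Dgf : differentiable (g \o f) z by exact: differentiable_comp.
apply: DeriveDef; first exact/derivable1_diffP.
rewrite deriveE // diff_comp //= -(deriveE _ Df) derive_val.
rewrite -[df]mulr1 -[df * 1]/(df *: 1) linearZ /= -(deriveE _ Dg) derive_val.
have -> : df *: (1 : K) = df by exact: mulr1.
exact: mulrC.
Qed.

End Derivative.

(** * Power series: absolute convergence, termwise differentiation, limit at 0 *)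

Section PowerSeries.
Variable K : numFieldType.
Hypothesis Kc : abs_complete K.
Variable Q : K.
Hypothesis Q_gt0 : 0 < Q.
Implicit Types (a : nat -> K) (z r x : K).

Definition psum a z : K := ssum (fun k => a k * z ^+ k).

(* The power series [psum a] has radius of convergence at least [Q^-1]. *)
Definition conv_radius a := forall r, 0 <= r -> r * Q < 1 ->
  exists M, forall k, `|a k| * r ^+ k <= M.

Lemma exists_larger_radius x : x * Q < 1 -> exists2 r, x < r & r * Q < 1.
Proof.
rewrite -ltr_pdivlMr // => /midf_lt [xm mQ].
by exists ((x + 1 / Q) / 2%:R) => //; rewrite -ltr_pdivlMr.
Qed.

(** Comparison with a geometric series of ratio x / r, for some r > x with r Q < 1. *)
Lemma conv_radius_sum_le a x : conv_radius a -> 0 <= x -> x * Q < 1 ->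
  exists M, forall n, \sum_(0 <= k < n) `|a k| * x ^+ k <= M.
Proof.
move=> ra x0 xQ; have [r xr rQ] := exists_larger_radius _ xQ.
have r0 : 0 < r := le_lt_trans x0 xr.
have [M aM] := ra r (ltW r0) rQ.
have M0 : 0 <= M.
  by apply: le_trans (aM 0%N); rewrite mulr_ge0 ?exprn_ge0 ?normr_ge0 // ltW.
exists (M * (1 - x / r)^-1) => n.
have xr0 : 0 <= x / r by rewrite divr_ge0 // ltW.
have xr1 : x / r < 1 by rewrite ltr_pdivrMr // mul1r.
apply: le_trans (ler_wpM2l M0 (sum_geometric_le _ _ n xr0 xr1)).
rewrite mulr_sumr; apply: ler_sum => k _.
have -> : x ^+ k = r ^+ k * (x / r) ^+ k.
  by rewrite -exprMn mulrCA divff ?mulr1 // gt_eqF.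
by rewrite mulrA; apply: ler_wpM2r => //; exact: exprn_ge0.
Qed.

Lemma conv_radius_abs_bounded a z : conv_radius a -> `|z| * Q < 1 ->
  abs_bounded (fun k => a k * z ^+ k).
Proof.
move=> ra zQ; have [M aM] := conv_radius_sum_le _ _ ra (normr_ge0 z) zQ.
by exists M => n; under eq_bigr do rewrite normrM normrX.
Qed.

Lemma cvg_psum a z : conv_radius a -> `|z| * Q < 1 ->
  (series (fun k => a k * z ^+ k) @ \oo --> psum a z)%classic.
Proof. by move=> ra zQ; apply: cvg_ssum => //; exact: conv_radius_abs_bounded. Qed.

(** With t = r / r' < 1, the factor k is absorbed by k t^k <= 1 + t + ... + t^(k-1) <= 1 / (1 -
    t). *)
Lemma conv_radius_mulrn a : conv_radius a -> conv_radius (fun k => k%:R * a k).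
Proof.
move=> ra r r0 rQ; have [r' rr' r'Q] := exists_larger_radius _ rQ.
have r'0 : 0 < r' := le_lt_trans r0 rr'.
have [M aM] := ra r' (ltW r'0) r'Q.
have t0 : 0 <= r / r' by rewrite divr_ge0 // ltW.
have t1 : r / r' < 1 by rewrite ltr_pdivrMr // mul1r.
exists (M * (1 - r / r')^-1) => k.
have -> : r ^+ k = r' ^+ k * (r / r') ^+ k.
  by rewrite -exprMn mulrCA divff ?mulr1 // gt_eqF.
have -> : `|k%:R * a k| * (r' ^+ k * (r / r') ^+ k)
   = (`|a k| * r' ^+ k) * (k%:R * (r / r') ^+ k).
  by rewrite normrM normr_nat; ring.
apply: ler_pM; rewrite ?mulr_ge0 ?exprn_ge0 ?ler0n ?normr_ge0 //; first exact: ltW.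
apply: le_trans (sum_geometric_le _ _ k t0 t1).
rewrite mulr_natl -[X in _ *+ X]subn0 -sumr_const_nat.
apply: ler_sum_nat => i /andP[_ ik]; by apply: (ler_wiXn2l t0 (ltW t1)); exact: ltnW.
Qed.

(* Second-order remainder of [z ^+ k]; dominated termwise by the same
   expression in [`|z|] and [d >= `|h|]. *)
Let rem z h k := (z + h) ^+ k - z ^+ k - k%:R * z ^+ k * h / z.

Let remS z h k : z != 0 ->
  rem z h k.+1 = (z + h) * rem z h k + k%:R * z ^+ k * h ^+ 2 / z.
Proof. by move=> z0; rewrite /rem !exprS -nat1r; field. Qed.

Let rem_le z h d k : z != 0 -> `|h| <= d ->
  `|rem z h k| * d ^+ 2 <= `|h| ^+ 2 * rem `|z| d k.
Proof.
move=> z0 hd; have d0 : 0 <= d := le_trans (normr_ge0 h) hd.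
elim: k => [|k IHk].
  by rewrite /rem !expr0 !subrr !mul0r !subr0 normr0 mul0r mulr0.
rewrite !remS ?normr_eq0 // [X in _ <= X]mulrDr.
apply: le_trans (ler_wpM2r (exprn_ge0 2 d0) (ler_normD _ _)) _.
rewrite [X in X <= _]mulrDl; apply: lerD.
  rewrite normrM -mulrA [X in _ <= X]mulrCA; apply: ler_pM => //.
    by rewrite mulr_ge0 // exprn_ge0.
  exact: le_trans (ler_normD _ _) (lerD (lexx _) hd).
rewrite !normrM normfV !normrX normr_nat le_eqVlt; apply/orP; left; apply/eqP.
by ring.
Qed.

Let rem_le_exp x d k : 0 <= x -> 0 <= d -> rem x d k <= (x + d) ^+ k.
Proof.
move=> x0 d0; rewrite /rem -addrA gerDl -opprD oppr_le0.
by rewrite addr_ge0 ?exprn_ge0 // divr_ge0 // !mulr_ge0 ?exprn_ge0 ?ler0n.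
Qed.

(** The error of the linear approximation is the sum of the a_k [rem z h k], each at most (|h| /
    d)^2 |a_k| r^k with r = |z| + d. Dividing by [z] in the derivative lets z d/dz act on
    coefficients as multiplication by k. *)
Lemma is_derive_psum a z : conv_radius a -> z != 0 -> `|z| * Q < 1 ->
  is_derive z 1 (psum a) (psum (fun k => k%:R * a k) z / z).
Proof.
move=> ra z0 zQ; have [r zr rQ] := exists_larger_radius _ zQ.
have r0 : 0 <= r := le_trans (normr_ge0 z) (ltW zr).
pose d := r - `|z|; have d0 : 0 < d by rewrite subr_gt0.
have dr : `|z| + d = r by rewrite /d addrC subrK.
have [M aM] := conv_radius_sum_le _ _ ra r0 rQ.
have M0 : 0 <= M by apply: le_trans (aM 0%N); rewrite big_nil.
apply: (is_derive_quadratic _ _ _ _ (M / d ^+ 2) d) => //.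
  by rewrite divr_ge0 // exprn_ge0 // ltW.
move=> h hd.
have zhQ : `|z + h| * Q < 1.
  apply: le_lt_trans rQ; apply: ler_wpM2r; first exact: ltW.
  by rewrite -dr; apply: le_trans (ler_normD _ _) (lerD (lexx _) hd).
have := cvg_seriesD _ _ _ _ _ (cvg_psum _ _ ra zhQ)
  (cvg_seriesZ _ _ (-1) _ (cvg_psum _ _ ra zQ)).
move=> /cvg_seriesD /(_ (cvg_seriesZ _ _ (- h / z) _
  (cvg_psum _ _ (conv_radius_mulrn _ ra) zQ))) /ssum_cvg.
have -> : psum a (z + h) + -1 * psum a z
    + - h / z * psum (fun k => k%:R * a k) z
  = psum a (z + h) - psum a z - h * (psum (fun k => k%:R * a k) z / z) by ring.
move=> <-; apply: norm_ssum_le => // n.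
apply: le_trans (_ : \sum_(0 <= k < n) (`|h| ^+ 2 / d ^+ 2) * (`|a k| * r ^+ k) <= _).
  apply: ler_sum => k _.
  have -> : a k * (z + h) ^+ k + -1 * (a k * z ^+ k)
     + - h / z * (k%:R * a k * z ^+ k) = a k * rem z h k by rewrite /rem; ring.
  rewrite normrM mulrCA; apply: ler_wpM2l => //.
  have d2 : 0 < d ^+ 2 by exact: exprn_gt0.
  rewrite mulrAC ler_pdivlMr //; apply: le_trans (rem_le _ _ _ k z0 hd) _.
  apply: ler_wpM2l; first exact: exprn_ge0.
  by rewrite -dr; apply: rem_le_exp => //; exact: ltW.
rewrite -mulr_sumr; have -> : M / d ^+ 2 * `|h| ^+ 2 = `|h| ^+ 2 / d ^+ 2 * M.
  by ring.
by apply: ler_wpM2l => //; rewrite divr_ge0 // exprn_ge0 // ltW.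
Qed.

(** As |x n| <= 1, every term beyond the constant one yields a factor |x n|, so the tail is at most
    |x n| times a bound for the sum of |a_k| |z|^k. *)
Lemma psum_cvg_0 a z (x : nat -> K) : conv_radius a -> `|z| * Q < 1 ->
  (forall n, `|x n| <= 1) -> (x @ \oo --> (0 : K))%classic ->
  ((fun n => psum a (z * x n)) @ \oo --> a 0%N)%classic.
Proof.
move=> ra zQ x1 x0; have [M aM] := conv_radius_sum_le _ _ ra (normr_ge0 z) zQ.
have M0 : 0 <= M by apply: le_trans (aM 0%N); rewrite big_nil.
have zxQ n : `|z * x n| * Q < 1.
  apply: le_lt_trans zQ; rewrite normrM; apply: ler_wpM2r; first exact: ltW.
  by rewrite ler_piMr.
have bnd n : `|psum a (z * x n) - a 0%N| <= `|x n| * M.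
  pose t k := a k.+1 * (z * x n) ^+ k.+1.
  have tM m : \sum_(0 <= k < m) `|t k| <= `|x n| * M.
    apply: (le_trans _ (ler_wpM2l (normr_ge0 (x n)) (aM m.+1))).
    rewrite big_nat_recl // mulrDr mulr_sumr; apply: ler_wpDl.
      by rewrite !mulr_ge0 ?exprn_ge0.
    apply: ler_sum => k _; rewrite /t normrM mulrCA; apply: ler_wpM2l => //.
    rewrite normrX normrM exprMn mulrC; apply: ler_wpM2r.
      exact: exprn_ge0.
    by rewrite exprS ler_piMr // exprn_ile1.
  have tb : abs_bounded t by exists (`|x n| * M).
  have -> : psum a (z * x n) = a 0%N + ssum t.
    have -> : a 0%N = a 0%N * (z * x n) ^+ 0 by rewrite expr0 mulr1.
    by apply: ssum_cvg; apply: cvg_series_recl; exact: cvg_ssum.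
  by rewrite addrC addKr; exact: norm_ssum_le.
apply/cvgrPdistC_lt => e e0.
have M1 : 0 < M + 1 by exact: ltr_wpDl.
have /cvgr0Pnorm_lt /(_ _ (divr_gt0 e0 M1)) := x0.
apply: filterS => n; rewrite ltr_pdivlMr // => xe.
apply: le_lt_trans (bnd n) _; apply: le_lt_trans xe.
by rewrite ler_wpM2l // lerDl.
Qed.

End PowerSeries.

(** * Euler products and Lambert series *)

Section EulerFamilies.
Variable K : numFieldType.
Variable U : set K.
Hypothesis U_nbhs : forall z, U z -> nbhs z U.
Hypothesis U_neq0 : forall z, U z -> z != 0.
Implicit Types F G : nat -> K -> K.

(* On [U], [F j] is the [j]-th iterate of [zeta_derive] on [F 0]. *)
Definition zfamily F :=
  forall j z, U z -> is_derive z 1 (F j) (F j.+1 z / z).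

(** [U] is a neighbourhood of each of its points, so a derivative there depends only on values in
    [U], where both functions agree by induction. *)
Lemma iter_zeta_derive F (f : K -> K) : zfamily F ->
  (forall z, U z -> f z = F 0%N z) ->
  forall j z, U z -> iter j (@zeta_derive K) f z = F j z.
Proof.
move=> fF f0; elim=> [|j IHj] z Uz /=; first exact: f0.
rewrite /zeta_derive derive1E.
have -> : 'D_1 (iter j (@zeta_derive K) f) z = 'D_1 (F j) z.
  by apply: near_eq_derive; move: (U_nbhs _ Uz); apply: filterS => w /IHj.
by rewrite (@derive_val _ _ _ _ _ _ _ (fF j z Uz)) mulrC divfK ?U_neq0.
Qed.

Lemma zfamilyZ (c : K) F : zfamily F -> zfamily (fun j z => c * F j z).
Proof.
move=> fF j z Uz; have Fz := fF j z Uz.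
have -> : (fun z => c * F j z) = c \*: F j by [].
by apply: is_derive_eq; exact: mulrA.
Qed.

Lemma zfamilyB F G :
  zfamily F -> zfamily G -> zfamily (fun j z => F j z - G j z).
Proof.
move=> fF fG j z Uz; have Fz := fF j z Uz; have Gz := fG j z Uz.
have -> : (fun z => F j z - G j z) = F j - G j by [].
by apply: is_derive_eq; rewrite mulrBl.
Qed.

(** Pascal's rule, the combinatorial half of Leibniz' rule [zfamilyM]. *)
Lemma binomial_convolutionS (f g : nat -> K) n :
  \sum_(j < n.+2) 'C(n.+1, j)%:R * (f j * g (n.+1 - j)%N)
  = \sum_(j < n.+1) 'C(n, j)%:R * (f j.+1 * g (n - j)%N + f j * g (n - j).+1).
Proof.
under [RHS]eq_bigr do rewrite mulrDr.
rewrite [RHS]big_split big_ord_recl /= bin0.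
under eq_bigr do rewrite /bump /= add1n binS natrD mulrDl.
rewrite big_split /= addrA [LHS]addrC; congr (_ + _).
transitivity (\sum_(j < n.+2) 'C(n, j)%:R * (f j * g (n.+1 - j)%N)).
  by rewrite [RHS]big_ord_recl /= bin0.
rewrite big_ord_recr /= bin_small // mul0r addr0; apply: eq_bigr => j _.
by rewrite subSn // -ltnS.
Qed.

Lemma zfamilyM F G : zfamily F -> zfamily G ->
  zfamily (fun n z => \sum_(j < n.+1) 'C(n, j)%:R * (F j z * G (n - j)%N z)).
Proof.
move=> fF fG n z Uz.
pose h (j : 'I_n.+1) := 'C(n, j)%:R \*: (F j * G (n - j)%N).
have -> : (fun z => \sum_(j < n.+1) 'C(n, j)%:R * (F j z * G (n - j)%N z))
    = \sum_(j < n.+1) h j.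
  by apply/funext => w; rewrite fct_sumE.
rewrite (binomial_convolutionS (F^~ z) (G^~ z)).
have dh j : is_derive z 1 (h j) ('C(n, j)%:R *:
    (F j z *: (G (n - j).+1 z / z) + G (n - j)%N z *: (F j.+1 z / z))).
  apply: is_deriveZ; apply: is_deriveM; [exact: fF | exact: fG].
apply: is_derive_eq; rewrite mulr_suml; apply: eq_bigr => j _.
rewrite -[_ *: (_ / z)]/(_ * (_ / z)) -[X in _ *: (_ + X)]/(_ * (_ / z)).
by rewrite -[_ *: _]/(_ * _); ring.
Qed.

(** Substituting 1/z changes the sign of z d/dz, whence (-1)^j. *)
Lemma zfamilyV F : (forall z, U z -> U z^-1) -> zfamily F ->
  zfamily (fun j z => (-1) ^+ j * F j z^-1).
Proof.
move=> U_inv fF j z Uz; have z0 := U_neq0 _ Uz.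
have dV : is_derive z 1 (fun w : K => w^-1) (- z ^- 2).
  have did : derivable (@idfun K) z 1 by exact: derivable_id.
  apply: DeriveDef; first exact: (derivableV z0 did).
  by rewrite (deriveV z0 did) derive_id; exact: mulr1.
have dF := is_derive_chain _ _ _ _ _ _ dV (fF j _ (U_inv _ Uz)).
have -> : (fun z => (-1) ^+ j * F j z^-1) = (-1) ^+ j \*: (fun z => F j z^-1) by [].
apply: is_derive_eq; rewrite -[_ *: _]/(_ * _) [(-1) ^+ j.+1]exprS.
move: (F j.+1 z^-1) => w; field.
by rewrite z0.
Qed.

End EulerFamilies.

(** * Euler's series, its infinite product and its logarithmic derivative *)

Section EulerProduct.
Variable K : numFieldType.
Hypothesis Kc : abs_complete K.
Variable q : K.
Hypotheses (q_neq0 : q != 0) (q_lt1 : `|q| < 1).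

Let Q_gt0 : 0 < `|q|. Proof. by rewrite normr_gt0. Qed.

Lemma norm1B_expn_ge k : 1 - `|q| <= `|1 - q ^+ k.+1|.
Proof.
apply: le_trans (lerB_dist _ _); rewrite normr1 normrX; apply: lerB => //.
by rewrite exprS ler_piMr // exprn_ile1 // ltW.
Qed.

Lemma onemX_neq0 k : 1 - q ^+ k.+1 != 0.
Proof.
by rewrite -normr_gt0; apply: lt_le_trans (norm1B_expn_ge k); rewrite subr_gt0.
Qed.

Definition euler_coef k : K := \prod_(i < k) (q / (1 - q ^+ i.+1)).

Lemma euler_coefS k : euler_coef k.+1 * (1 - q ^+ k.+1) = q * euler_coef k.
Proof. by rewrite /euler_coef big_ord_recr /= mulrA divfK ?onemX_neq0 // mulrC. Qed.

(* [lambert_coef 0 = 1 / 0 = 0] *)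
Definition lambert_coef k : K := q ^+ k / (1 - q ^+ k).

Lemma lambert_coef0 : lambert_coef 0 = 0.
Proof. by rewrite /lambert_coef expr0 subrr invr0 mulr0. Qed.

Lemma lambert_coefS k : lambert_coef k.+1 * (1 - q ^+ k.+1) = q ^+ k.+1.
Proof. by rewrite /lambert_coef divfK ?onemX_neq0. Qed.

(** The sum of the first terms bounds each of them, and monotonicity extends the bound. *)
Lemma eventually_nonincreasing_bounded (t : nat -> K) N :
  (forall k, 0 <= t k) -> (forall k, (N <= k)%N -> t k.+1 <= t k) ->
  exists M, forall k, t k <= M.
Proof.
move=> t0 tN; exists (\sum_(i < N.+1) t i) => k.
have small i : (i <= N)%N -> t i <= \sum_(i < N.+1) t i.
  move=> iN; rewrite (bigD1 (Ordinal (iN : (i < N.+1)%N))) //= lerDl.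
  exact: sumr_ge0.
have [kN|/ltnW Nk] := leqP k N; first exact: small.
rewrite -(subnK Nk); elim: (k - N)%N => [|i IHi]; first exact: small.
by rewrite addSn; apply: le_trans (tN _ (leq_addl _ _)) IHi.
Qed.

(** The ratio of consecutive terms, r |q| / |1 - q^(k+1)|, is at most 1 once |q^(k+1)| < 1 - r
    |q|. *)
Lemma conv_radius_euler_coef : conv_radius K `|q| euler_coef.
Proof.
move=> r r0 rQ.
have /cvgr0Pnorm_lt /(_ (1 - r * `|q|)) := cvg_expn_0 _ Kc _ q_lt1.
rewrite subr_gt0 => /(_ rQ) [N _ HN].
apply: (eventually_nonincreasing_bounded _ N) => [k|k Nk].
  by rewrite mulr_ge0 // exprn_ge0.
have rk : r * `|q| <= `|1 - q ^+ k.+1|.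
  apply: le_trans (lerB_dist _ _); rewrite normr1 lerBrDl -lerBrDr ltW //.
  by apply: HN => /=; exact: leqW.
rewrite /euler_coef big_ord_recr /= normrM [r ^+ _]exprS -mulrA; apply: ler_wpM2l => //.
rewrite normf_div mulrA; apply: ler_piMl; first exact: exprn_ge0.
rewrite mulrAC ler_pdivrMr ?mul1r 1?mulrC //.
by rewrite normr_gt0 onemX_neq0.
Qed.

Lemma conv_radius_expn : conv_radius K `|q| (fun k => q ^+ k).
Proof.
move=> r r0 rQ; exists 1 => k; rewrite normrX -exprMn mulrC.
by rewrite exprn_ile1 ?mulr_ge0 // ltW.
Qed.

Lemma conv_radius_lambert_coef : conv_radius K `|q| lambert_coef.
Proof.
move=> r r0 rQ; exists (1 - `|q|)^-1 => -[|k].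
  by rewrite lambert_coef0 normr0 mul0r invr_ge0 subr_ge0 ltW.
have n1 : 0 < `|1 - q ^+ k.+1| by rewrite normr_gt0 onemX_neq0.
rewrite /lambert_coef normf_div mulrAC normrX -exprMn ler_pdivrMr //.
apply: (@le_trans _ _ 1).
  by rewrite exprn_ile1 ?mulr_ge0 // mulrC ltW.
by rewrite ler_pdivlMl ?mulr1 ?norm1B_expn_ge // subr_gt0.
Qed.

Local Notation B := (psum K euler_coef).
Local Notation DB := (psum K (fun k => k%:R * euler_coef k)).
Local Notation P := (psum K lambert_coef).

Let cvg_ps := cvg_psum K Kc `|q| Q_gt0.

Lemma mulq_disc z : `|z| * `|q| < 1 -> `|z * q| * `|q| < 1.
Proof.
move=> zQ; apply: le_lt_trans zQ; rewrite normrM; apply: ler_wpM2r => //.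
by rewrite ler_piMr // ltW.
Qed.

(** The constant terms cancel, z^k becomes (1 - q^k) z^k, and an index shift extracts the factor
    [z]. *)
Lemma psum_qdiff a z s : conv_radius K `|q| a -> `|z| * `|q| < 1 ->
  (series (fun k => a k.+1 * (1 - q ^+ k.+1) * z ^+ k) @ \oo --> s)%classic ->
  psum K a z - psum K a (z * q) = z * s.
Proof.
move=> ra zQ /(cvg_seriesZ _ _ z) cvs.
have := cvg_seriesD _ _ _ _ _ (cvg_ps _ _ ra zQ)
  (cvg_seriesZ _ _ (-1) _ (cvg_ps _ _ ra (mulq_disc _ zQ))).
move=> /ssum_cvg; rewrite mulN1r => <-.
have -> : z * s = (a 0%N * z ^+ 0 + -1 * (a 0%N * (z * q) ^+ 0)) + z * s.
  by rewrite !expr0 mulN1r subrr add0r.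
apply: ssum_cvg; apply: cvg_series_recl.
apply: eq_cvg_series cvs => k.
by rewrite exprMn !exprS; ring.
Qed.

Lemma euler_qdiff z : `|z| * `|q| < 1 -> B (z * q) = (1 - z * q) * B z.
Proof.
move=> zQ; have : B z - B (z * q) = z * (q * B z).
  apply: psum_qdiff => //; first exact: conv_radius_euler_coef.
  have := cvg_seriesZ _ _ q _ (cvg_ps _ _ conv_radius_euler_coef zQ).
  by apply: eq_cvg_series => k; rewrite mulrA -euler_coefS.
by move=> /eqP; rewrite subr_eq => /eqP e; rewrite mulrBl mul1r {1}e; ring.
Qed.

(** This is z d/dz of [euler_qdiff], obtained on coefficients from (k+1) b_(k+1) (1 - q^(k+1)) = q
    (k b_k + b_k). *)
Lemma euler_deriv_qdiff z : `|z| * `|q| < 1 ->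
  DB (z * q) = (1 - z * q) * DB z - z * q * B z.
Proof.
move=> zQ; have rD := conv_radius_mulrn _ _ Q_gt0 _ conv_radius_euler_coef.
have : DB z - DB (z * q) = z * (q * (DB z + B z)).
  apply: psum_qdiff => //.
  have := cvg_seriesZ _ _ q _ (cvg_seriesD _ _ _ _ _ (cvg_ps _ _ rD zQ)
    (cvg_ps _ _ conv_radius_euler_coef zQ)).
  apply: eq_cvg_series => k.
  by rewrite -[X in _ = X * _]mulrA euler_coefS -nat1r; ring.
by move=> /eqP; rewrite subr_eq => /eqP e; rewrite mulrBl mul1r {1}e; ring.
Qed.

Lemma mulq_neq1 z : `|z| * `|q| < 1 -> 1 - z * q != 0.
Proof.
move=> zQ; rewrite subr_eq0; apply/eqP => e.
by move: zQ; rewrite -normrM -e normr1 ltxx.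
Qed.

Lemma lambert_qdiff z : `|z| * `|q| < 1 ->
  P z - P (z * q) = z * q / (1 - z * q).
Proof.
move=> zQ; rewrite -mulrA; apply: psum_qdiff => //; first exact: conv_radius_lambert_coef.
have c1 := cvg_ps _ _ conv_radius_expn zQ; set g := psum _ _ _ in c1.
have c2 : (series (fun k => q ^+ k * z ^+ k) @ \oo --> 1 + z * q * g)%classic.
  have -> : (1 : K) = q ^+ 0 * z ^+ 0 by rewrite !expr0 mulr1.
  apply: (cvg_series_recl _ (fun k => q ^+ k * z ^+ k)).
  have := cvg_seriesZ _ _ (z * q) _ c1.
  apply: eq_cvg_series => k.
  by rewrite !exprS; ring.
(* Splitting off the first term evaluates the geometric series: g = 1 / (1 - zq). *)
have g1 : g = 1 + z * q * g := cvg_unique (@norm_hausdorff _ _) c1 c2.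
have -> : q / (1 - z * q) = q * g.
  rewrite -[q * g](mulfK (mulq_neq1 _ zQ)); congr (_ / _).
  by rewrite mulrBr mulr1 {1}g1; ring.
have := cvg_seriesZ _ _ q _ c1; apply: eq_cvg_series => k.
by rewrite lambert_coefS exprS mulrA.
Qed.

Lemma qinvariant_expn (H : K -> K) z : `|z| * `|q| < 1 ->
  (forall w, `|w| * `|q| < 1 -> H (w * q) = (1 - w * q) * H w) ->
  forall N, H (z * q ^+ N) = (\prod_(0 <= n < N) (1 - z * q * q ^+ n)) * H z.
Proof.
move=> zQ Hq; elim=> [|N IHN]; first by rewrite big_nil mul1r expr0 mulr1.
have zN : `|z * q ^+ N| * `|q| < 1.
  elim: N {IHN} => [|N IHN]; first by rewrite expr0 mulr1.
  by rewrite exprSr mulrA; exact: mulq_disc.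
by rewrite exprSr mulrA Hq // IHN big_nat_recr //= [in LHS]mulrAC; ring.
Qed.

Lemma psum_mulqX_cvg a z : conv_radius K `|q| a -> `|z| * `|q| < 1 ->
  ((fun N => psum K a (z * q ^+ N)) @ \oo --> a 0%N)%classic.
Proof.
move=> ra zQ; apply: (psum_cvg_0 _ Kc `|q| Q_gt0 _ _ (fun n => q ^+ n)) => //.
  by move=> n; rewrite normrX exprn_ile1 // ltW.
exact: cvg_expn_0.
Qed.

Lemma euler_coef0 : euler_coef 0 = 1.
Proof. by rewrite /euler_coef big_ord0. Qed.

(** A zero at [z] would propagate to every z q^N by the functional equation, but B(z q^N) tends to
    b_0 = 1. *)
Lemma euler_neq0 z : `|z| * `|q| < 1 -> B z != 0.
Proof.
move=> zQ; apply/eqP => Bz; have := psum_mulqX_cvg _ _ conv_radius_euler_coef zQ.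
under eq_fun do rewrite (qinvariant_expn _ _ zQ euler_qdiff) Bz mulr0.
move=> c1; have := cvg_unique (@norm_hausdorff _ _) c1 (cvg_cst (0 : K)).
by rewrite euler_coef0 => e10; move: (oner_neq0 K); rewrite [1]e10 eqxx.
Qed.

Lemma cvg_euler_prod z : `|z| * `|q| < 1 ->
  ((fun N => \prod_(0 <= n < N) (1 - z * q * q ^+ n)) @ \oo --> (B z)^-1)%classic.
Proof.
move=> zQ; have Bz := euler_neq0 _ zQ.
have -> : (fun N => \prod_(0 <= n < N) (1 - z * q * q ^+ n))
    = (fun N => B (z * q ^+ N) * (B z)^-1).
  apply/funext => N; rewrite (qinvariant_expn _ _ zQ euler_qdiff).
  by rewrite mulfK.
rewrite -[X in (_ --> X)%classic]mul1r; apply: cvgM; last exact: cvg_cst.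
by rewrite -euler_coef0; exact: psum_mulqX_cvg conv_radius_euler_coef zQ.
Qed.

Lemma qpoch_euler z : `|z| * `|q| < 1 -> qpoch (z * q) q = (B z)^-1.
Proof.
move=> zQ; apply: cvg_lim; first exact: norm_hausdorff.
exact: cvg_euler_prod.
Qed.

(* The quotient of [DB - B * P] by [B] is invariant under [z -> z * q], and
   vanishes at [0]. *)
Lemma euler_log_derive z : `|z| * `|q| < 1 -> DB z = B z * P z.
Proof.
move=> zQ; pose H w := DB w - B w * P w.
have Hq w : `|w| * `|q| < 1 -> H (w * q) = (1 - w * q) * H w.
  move=> wQ; have w1 := mulq_neq1 _ wQ; have := lambert_qdiff _ wQ.
  move/eqP; rewrite subr_eq => /eqP Pw.
  rewrite /H euler_deriv_qdiff // euler_qdiff // Pw.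
  by field.
have rD := conv_radius_mulrn _ _ Q_gt0 _ conv_radius_euler_coef.
have H0 : ((fun N => H (z * q ^+ N)) @ \oo --> (0 : K))%classic.
  have -> : (0 : K) = 0%:R * euler_coef 0 - euler_coef 0 * lambert_coef 0.
    by rewrite lambert_coef0 mul0r mulr0 subr0.
  apply: cvgB; first exact: psum_mulqX_cvg rD zQ.
  apply: cvgM; first exact: psum_mulqX_cvg conv_radius_euler_coef zQ.
  exact: psum_mulqX_cvg conv_radius_lambert_coef zQ.
have H1 : ((fun N => H (z * q ^+ N)) @ \oo --> (B z)^-1 * H z)%classic.
  under eq_fun do rewrite (qinvariant_expn _ _ zQ Hq).
  by apply: cvgM; [exact: cvg_euler_prod | exact: cvg_cst].
have BH0 := cvg_unique (@norm_hausdorff _ _) H1 H0.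
apply: subr0_eq; apply: (mulfI (invr_neq0 (euler_neq0 _ zQ))).
rewrite mulr0. exact: BH0.
Qed.

End EulerProduct.

(** * Generating series of divisor sums as Lambert series *)

Section Lambert.
Variable K : numFieldType.
Hypothesis Kc : abs_complete K.
Variable q : K.
Hypotheses (q_neq0 : q != 0) (q_lt1 : `|q| < 1).

Let Q_gt0 : 0 < `|q|. Proof. by rewrite normr_gt0. Qed.
Let one_disc : `|1 : K| * `|q| < 1. Proof. by rewrite normr1 mul1r. Qed.

Lemma conv_radius_mulXn (a : nat -> K) j : conv_radius K `|q| a ->
  conv_radius K `|q| (fun k => k%:R ^+ j * a k).
Proof.
move=> ra; elim: j => [|j IHj].
  by have -> : (fun k => k%:R ^+ 0 * a k) = a by apply/funext => k; rewrite mul1r.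
have -> : (fun k => k%:R ^+ j.+1 * a k) = (fun k => k%:R * (k%:R ^+ j * a k)).
  by apply/funext => k; rewrite exprS mulrA.
exact: conv_radius_mulrn.
Qed.

(** A finite geometric sum in q^d; the last exponent is the first multiple of [d] beyond [N]. *)
Lemma sum_multiples_expn d N : (0 < d)%N ->
  (1 - q ^+ d) * \sum_(1 <= n < N.+1 | (d %| n)%N) q ^+ n
    = q ^+ d - q ^+ (d * (N %/ d).+1).
Proof.
move=> d0; elim: N => [|N IHN]; first by rewrite big_geq // div0n muln1 subrr mulr0.
rewrite big_mkcond big_nat_recr //= -big_mkcond mulrDr IHN divnS //.
case: ifP => dN; last by rewrite mulr0 addr0 add0n.
have -> : N.+1 = (d * (N %/ d).+1)%N.
  by rewrite -{1}(divnK dN) divnS // dN add1n mulnC.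
by rewrite add1n [(d * (N %/ d).+2)%N]mulnS exprD; ring.
Qed.

Lemma sum_sigma_expn j N :
  \sum_(1 <= n < N.+1) (sigma j n)%:R * q ^+ n
  = \sum_(1 <= d < N.+1) d%:R ^+ j * \sum_(1 <= n < N.+1 | (d %| n)%N) q ^+ n.
Proof.
under [RHS]eq_bigr do rewrite mulr_sumr big_mkcond.
rewrite exchange_big; apply: eq_big_nat => n /andP[n1 nN].
rewrite /sigma natr_sum mulr_suml.
have -> : \sum_(d <- divisors n) (d ^ j)%:R * q ^+ n
   = \sum_(1 <= d < N.+1 | (d %| n)%N) (d ^ j)%:R * q ^+ n.
  rewrite -[RHS]big_filter; apply: perm_big; apply: uniq_perm.
  - exact: divisors_uniq.
  - by rewrite filter_uniq // iota_uniq.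
  move=> d; rewrite mem_filter -dvdn_divisors // mem_index_iota.
  case dn: (d %| n)%N => //=; symmetry.
  by rewrite (dvdn_gt0 n1 dn) ltnS (leq_trans (dvdn_leq n1 dn)).
by rewrite [LHS]big_mkcond; apply: eq_bigr => d _; case: ifP; rewrite ?natrX.
Qed.

(** Cutting at [N] leaves for each [d] a tail d^j q^m / (1 - q^d) with m > N; summing at most N + 1
    such bounds gives the extra power of N + 1. *)
Lemma lambert_sum_remainder j N :
  `|\sum_(1 <= n < N.+1) (sigma j n)%:R * q ^+ n
    - \sum_(1 <= d < N.+1) d%:R ^+ j * lambert_coef K q d|
  <= (1 - `|q|)^-1 * (N.+1%:R ^+ j.+1 * `|q| ^+ N.+1).
Proof.
rewrite sum_sigma_expn -sumrB; apply: le_trans (ler_norm_sum _ _ _) _.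
apply: (@le_trans _ _ (\sum_(1 <= d < N.+1)
    (1 - `|q|)^-1 * (N.+1%:R ^+ j * `|q| ^+ N.+1))); last first.
  rewrite sumr_const_nat subSS subn0 -mulrnAr; apply: ler_wpM2l.
    by rewrite invr_ge0 subr_ge0 ltW.
  rewrite -mulr_natl mulrA; apply: ler_wpM2r; first by rewrite exprn_ge0.
  by rewrite exprS; apply: ler_wpM2r; rewrite ?exprn_ge0 // ler_nat.
apply: ler_sum_nat => -[//|d] /andP[_ dN].
have d1 := onemX_neq0 K q q_lt1 d.
have -> : \sum_(1 <= n < N.+1 | (d.+1 %| n)%N) q ^+ n
   = (q ^+ d.+1 - q ^+ (d.+1 * (N %/ d.+1).+1)) / (1 - q ^+ d.+1).
  by rewrite -sum_multiples_expn // mulrC mulKf.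
rewrite /lambert_coef -mulrBr -mulrBl addrAC subrr add0r mulNr mulrN normrN.
rewrite normrM normrX normr_nat normf_div mulrC mulrAC mulrC.
apply: ler_pM; rewrite ?invr_ge0 ?mulr_ge0 ?exprn_ge0 //.
  by rewrite lef_pV2 ?posrE ?norm1B_expn_ge ?subr_gt0 // normr_gt0.
rewrite mulrC; apply: ler_pM; rewrite ?exprn_ge0 //.
  by apply: lerXn2r; rewrite ?nnegrE // ler_nat ltnW.
rewrite normrX; apply: ler_wiXn2l => //; first exact: ltW.
by rewrite mulnC ltn_ceil.
Qed.

Lemma lambert_series j :
  \big[+%R/0]_(1 <= n <oo) ((sigma j n)%:R * q ^+ n)
  = psum K (fun k => k%:R ^+ j * lambert_coef K q k) 1.
Proof.
apply: cvg_lim; first exact: norm_hausdorff.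
rewrite -cvg_shiftS /=.
have rl := conv_radius_mulXn _ j (conv_radius_lambert_coef K q q_lt1).
have cl := cvg_psum K Kc _ Q_gt0 _ _ rl one_disc.
rewrite -cvg_shiftS in cl.
pose u N : K := (1 - `|q|)^-1 * (N.+1%:R ^+ j.+1 * q ^+ N.+1).
have u0 : (u @ \oo --> (0 : K))%classic.
  rewrite -(mulr0 (1 - `|q|)^-1); apply: cvgM; first exact: cvg_cst.
  have re := conv_radius_mulXn _ j.+1 (conv_radius_expn K q).
  have ce := cvg_psum K Kc _ Q_gt0 _ _ re one_disc.
  have := cvg_series_cvg_0 (cvgP _ ce); rewrite -cvg_shiftS /=.
  by under eq_fun do rewrite expr1n mulr1.
pose S N := \sum_(1 <= n < N.+1) (sigma j n)%:R * q ^+ n.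
pose T N := series (fun k => k%:R ^+ j * lambert_coef K q k * 1 ^+ k) N.+1.
have ST0 : ((fun N => S N - T N) @ \oo --> (0 : K))%classic.
  apply/cvgr0Pnorm_lt => e e0; move/cvgr0Pnorm_lt: u0 => /(_ e e0).
  apply: filterS => N; apply: le_lt_trans.
  have -> : T N = \sum_(1 <= d < N.+1) d%:R ^+ j * lambert_coef K q d.
    rewrite /T /series /= big_ltn // lambert_coef0 mulr0 mul0r add0r.
    by apply: eq_bigr => k _; rewrite expr1n mulr1.
  apply: le_trans (lambert_sum_remainder _ _) _.
  rewrite /u !normrM !normrX normr_nat ler_wpM2r ?mulr_ge0 ?exprn_ge0 //.
  by rewrite ger0_norm // invr_ge0 subr_ge0 ltW.
have SE : S = (fun N => (S N - T N) + T N) by apply/funext => N; rewrite subrK.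
suff : (S @ \oo --> 0 + psum K (fun k => k%:R ^+ j * lambert_coef K q k) 1)%classic.
  by rewrite add0r.
by rewrite SE; exact: cvgD.
Qed.

End Lambert.

(** * Moments of the residual crank *)

Section CrankMoments.
Variable K : numFieldType.
Hypothesis Kc : abs_complete K.
Variable q : K.
Hypotheses (q_neq0 : q != 0) (q_lt1 : `|q| < 1).

Let Q_gt0 : 0 < `|q|. Proof. by rewrite normr_gt0. Qed.

(** The annulus |q| < |z| < 1/|q|, where B(z) and B(1/z) both converge; it is stable under inversion
    and contains 1. *)
Let U : set K := fun z => `|q| < `|z| /\ `|z| * `|q| < 1.

Let U_neq0 z : U z -> z != 0.
Proof. by case=> qz _; rewrite -normr_gt0; exact: lt_trans qz. Qed.

Let U_nbhs z : U z -> nbhs z U.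
Proof.
case=> qz zq; have [r zr rq] := exists_larger_radius K _ Q_gt0 _ zq.
have n1 : \forall w \near z, `|z - w| < `|z| - `|q|.
  by apply/nbhs_normP; exists (`|z| - `|q|) => //=; rewrite subr_gt0.
have n2 : \forall w \near z, `|z - w| < r - `|z|.
  by apply/nbhs_normP; exists (r - `|z|) => //=; rewrite subr_gt0.
near=> w; split.
  have : `|z - w| < `|z| - `|q| by near: w.
  rewrite ltrBrDl -ltrBrDr => /lt_le_trans; apply.
  by rewrite -{2}[w](subKr z) lerB_dist.
apply: le_lt_trans rq; apply: ler_wpM2r => //.
have : `|z - w| < r - `|z| by near: w.
rewrite ltrBrDl => /ltW; apply: le_trans.
by rewrite -{1}[w](subKr z); exact: ler_normB.
Unshelve. all: by end_near. Qed.

Let U_inv z : U z -> U z^-1.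
Proof.
move=> Uz; have z0 : 0 < `|z| by rewrite normr_gt0 U_neq0.
case: Uz => qz zq; split; rewrite normfV.
  by rewrite -[X in _ < X]mul1r ltr_pdivlMr // mulrC.
by rewrite ltr_pdivrMl // mulr1.
Qed.

Let U1 : U 1. Proof. by rewrite /U normr1 mul1r. Qed.

Lemma zfamily_psum (a : nat -> K) : conv_radius K `|q| a ->
  zfamily K U (fun j => psum K (fun k => k%:R ^+ j * a k)).
Proof.
move=> ra j z Uz; have [_ zq] := Uz.
have ra_j := conv_radius_mulXn K q q_neq0 a j ra.
have d := is_derive_psum K Kc _ Q_gt0 _ _ ra_j (U_neq0 _ Uz) zq.
apply: (is_derive_eq d); congr (psum K _ z / z).
by apply/funext => k; rewrite exprS mulrA.
Qed.

(** [B j] and [P j] are the iterates of z d/dz on Euler's series and on the Lambert series; [P j 1]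
    is the sum of sigma_j(n) q^n by [lambert_series]. *)
Let B j := psum K (fun k => k%:R ^+ j * euler_coef K q k).
Let P j := psum K (fun k => k%:R ^+ j * lambert_coef K q k).

Let B0E : B 0%N = psum K (euler_coef K q).
Proof. by congr psum; apply/funext => k; rewrite mul1r. Qed.

Let P0E : P 0%N = psum K (lambert_coef K q).
Proof. by congr psum; apply/funext => k; rewrite mul1r. Qed.

Let B1E z : U z -> B 1%N z = B 0%N z * P 0%N z.
Proof.
by move=> [_ zq]; rewrite B0E P0E -(euler_log_derive K Kc q).
Qed.

Let c := qpoch (q ^+ 2) (q ^+ 2).

Let c_neq0 : c != 0.
Proof.
have q2 : `|q ^+ 2| < 1 by rewrite normrX expr2 mulr_ilt1.
have q20 : q ^+ 2 != 0 by rewrite expf_neq0.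
have := qpoch_euler K Kc _ q20 q2 1; rewrite mul1r normr1 mul1r => /(_ q2).
rewrite /c => ->; rewrite invr_eq0; apply: euler_neq0 => //.
by rewrite normr1 mul1r.
Qed.

(** Leibniz' rule for the iterates of z d/dz on c B(z) B(1/z); [L 0] is the logarithmic derivative
    and [L j] its iterates. *)
Let F n z := c * \sum_(j < n.+1) 'C(n, j)%:R *
  (B j z * ((-1) ^+ (n - j) * B (n - j)%N z^-1)).
Let L j z := P j z - (-1) ^+ j * P j z^-1.

Let zF : zfamily K U F.
Proof.
apply: zfamilyZ; apply: (zfamilyM K U B (fun j z => (-1) ^+ j * B j z^-1)).
  exact: zfamily_psum (conv_radius_euler_coef K Kc q q_lt1).
apply: (zfamilyV K U U_neq0 _ U_inv).
exact: zfamily_psum (conv_radius_euler_coef K Kc q q_lt1).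
Qed.

Let zL : zfamily K U L.
Proof.
have zP := zfamily_psum _ (conv_radius_lambert_coef K q q_lt1).
by apply: zfamilyB => //; exact: (zfamilyV K U U_neq0 _ U_inv).
Qed.

Let F0E z : F 0%N z = c * (B 0%N z * B 0%N z^-1).
Proof. by rewrite /F big_ord1 /= bin0 subnn expr0 !mul1r. Qed.

Let residual_crankE z : U z -> residual_crank z q = F 0%N z.
Proof.
move=> Uz; have [_ zq] := Uz; have [_ zVq] := U_inv _ Uz.
rewrite /residual_crank F0E B0E -/c; congr (_ * _).
rewrite [q / z]mulrC !(qpoch_euler K Kc q) //.
by rewrite -invfM invrK.
Qed.

Let F1E z : U z -> F 1%N z = F 0%N z * L 0%N z.
Proof.
move=> Uz; rewrite F0E /F /L !big_ord_recl big_ord0 /= /bump /= bin0 binn subnn.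
rewrite subn0 addn0 !expr0 expr1 !B1E //; last exact: U_inv.
by ring.
Qed.

(** Both sides are the iterates of z d/dz on [F 1], the right one by Leibniz' rule because F 1 = F 0
    L 0 on [U]. *)
Let FS z n : U z ->
  F n.+1 z = \sum_(j < n.+1) 'C(n, j)%:R * (F j z * L (n - j)%N z).
Proof.
move=> Uz; have zF' : zfamily K U (fun j => F j.+1) by move=> j; exact: zF.
have zFL := zfamilyM K U _ _ zF zL.
rewrite -(iter_zeta_derive K U U_nbhs U_neq0 _ (F 1%N) zF') //.
apply: (iter_zeta_derive K U U_nbhs U_neq0 _ _ zFL) => // w Uw.
by rewrite big_ord1 bin0 mul1r subnn F1E.
Qed.

Let crank_momentE r : crank_moment r q = F r 1 / F 0%N 1.
Proof.
rewrite /crank_moment residual_crankE //.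
by rewrite (iter_zeta_derive K U U_nbhs U_neq0 _ _ zF) // => z /residual_crankE.
Qed.

Let F0_neq0 : F 0%N 1 != 0.
Proof.
by rewrite F0E invr1 B0E !mulf_neq0 // euler_neq0 // normr1 mul1r.
Qed.

Lemma crank_moment0 : crank_moment 0 q = 1.
Proof. by rewrite crank_momentE divff. Qed.

Lemma crank_momentS n : crank_moment n.+1 q =
  \sum_(j < n.+1) 'C(n, j)%:R * (crank_moment j q *
     ((1 - (-1) ^+ (n - j)) * P (n - j)%N 1)).
Proof.
rewrite crank_momentE FS // mulr_suml; apply: eq_bigr => j _.
by rewrite crank_momentE /L invr1; ring.
Qed.

(** In the recurrence for odd order n + 1, terms with odd [j] vanish by induction; for even [j], n -
    j is even and 1 - (-1)^(n-j) = 0. *)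
Lemma crank_moment_odd n : odd n -> crank_moment n q = 0.
Proof.
elim/ltn_ind: n => -[//|n] IHn /= n_even; rewrite crank_momentS big1 // => j _.
have jn : (j <= n)%N by rewrite -ltnS.
have [oj|ej] := boolP (odd j); first by rewrite IHn // mul0r mulr0.
by rewrite -signr_odd oddB // (negPf n_even) (negPf ej) subrr mul0r !mulr0.
Qed.

Lemma sum_even_odd (f : nat -> K) n :
  \sum_(j < n.*2) f j = \sum_(m < n) (f m.*2 + f m.*2.+1).
Proof.
by elim: n => [|n IHn]; rewrite ?big_ord0 // doubleS !big_ord_recr /= IHn addrA.
Qed.

(** Only j = 2 (n - k) survives in [crank_momentS]; then 2n + 1 - j = 2k + 1 is odd, which gives the
    factor 2, and binomial symmetry rewrites the coefficient. *)
Lemma crank_moment_even n : crank_moment (2 * n.+1) q =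
  \sum_(k < n.+1) 'C(n.*2.+1, k.*2.+1)%:R *
    (2 * \big[+%R/0]_(1 <= m <oo) ((sigma (2 * k.+1).-1 m)%:R * q ^+ m)) *
    crank_moment (2 * (n - k)) q.
Proof.
rewrite mul2n doubleS crank_momentS -doubleS.
pose f j := 'C(n.*2.+1, j)%:R * (crank_moment j q *
     ((1 - (-1) ^+ (n.*2.+1 - j)) * P (n.*2.+1 - j)%N 1)).
rewrite (sum_even_odd f) (reindex_inj rev_ord_inj); apply: eq_bigr => k _.
have kn : (k <= n)%N by rewrite -ltnS.
have -> : ((2 * k.+1).-1 = k.*2.+1)%N by rewrite mul2n.
rewrite lambert_series // -/(P _) /= subSS mul2n /f.
rewrite [crank_moment _.+1 q]crank_moment_odd /= ?odd_double // mul0r mulr0 addr0.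
have -> : (n.*2.+1 - (n - k).*2 = k.*2.+1)%N.
  by rewrite doubleB subnBA ?leq_double // addSnnS addKn.
rewrite -signr_odd /= odd_double expr1 opprK.
have -> : 'C(n.*2.+1, (n - k).*2) = 'C(n.*2.+1, k.*2.+1).
  by rewrite -[RHS]bin_sub ?ltnS ?leq_double // subSS doubleB.
by ring.
Qed.

Lemma crank_moment_traces s : (0 < s)%N ->
  crank_moment (2 * s) q
    = part_trace (@PsiT _ s)
        (fun k => eisenstein k q + ratr (bernoulli (2 * k)) / (4 * k)%:R)
  /\
  eisenstein s q
    = - (ratr (bernoulli (2 * s)) / (4 * s)%:R)
      + part_trace (@PsiV _ s) (fun k => crank_moment (2 * k) q).
Proof.
move=> s_gt0.
(* Adding the Bernoulli term back leaves only the divisor sum series. *)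
pose e k : K := eisenstein k q + ratr (bernoulli (2 * k)) / (4 * k)%:R.
have a0 : crank_moment (2 * 0) q = 1 by rewrite muln0 crank_moment0.
have a_rec n : crank_moment (2 * n.+1) q = \sum_(k < n.+1)
   'C(n.*2.+1, k.*2.+1)%:R * (2 * e k.+1) * crank_moment (2 * (n - k)) q.
  rewrite crank_moment_even; apply: eq_bigr => k _.
  by rewrite /e /eisenstein [- _ + _]addrC subrK.
split.
  exact: (part_trace_PsiT _ (fun k => crank_moment (2 * k) q) e a0 a_rec).
rewrite -(part_trace_PsiV _ (fun k => crank_moment (2 * k) q) e a0 a_rec) //.
by rewrite /e [_ + ratr _ / _]addrC addKr.
Qed.

End CrankMoments.

(** * Specialization to the complex numbers *)

Section ComplexNumbers.
Variable R : realType.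

Lemma norm_complex_le (z : R[i]) :
  `|z| <= (`|complex.Re z| + `|complex.Im z|)%:C.
Proof.
rewrite normc_def lecR -[X in _ <= X]ger0_norm ?addr_ge0 // -sqrtr_sqr.
apply: ler_wsqrtr; rewrite sqrrD !real_normK ?num_real // lerD2r lerDl.
by rewrite mulrn_wge0 // mulr_ge0.
Qed.

Lemma norm_complex_ge_Im (z : R[i]) : `|complex.Im z|%:C <= `|z|.
Proof.
by rewrite normc_def lecR -sqrtr_sqr; apply: ler_wsqrtr; rewrite lerDr sqr_ge0.
Qed.

Lemma Re_series (u : nat -> R[i]) n :
  complex.Re (series u n) = series (fun k => complex.Re (u k)) n.
Proof. exact: (raddf_sum (@complex.Re R : {additive Rcomplex R -> R})). Qed.

Lemma Im_series (u : nat -> R[i]) n :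
  complex.Im (series u n) = series (fun k => complex.Im (u k)) n.
Proof. exact: (raddf_sum (@complex.Im R : {additive Rcomplex R -> R})). Qed.

(** Partial sums of |Re u_k| and |Im u_k| are nondecreasing and bounded, so both real series
    converge, and their limits form the complex one. *)
Lemma complex_abs_complete : abs_complete (R[i] : numFieldType).
Proof.
move=> u [M uM].
have M0 : 0 <= M by have := uM 0%N; rewrite big_nil.
(* A nonnegative complex number is real, so [M] provides a bound in [R]. *)
have MR : (complex.Re M)%:C = M by rewrite RRe_real // ger0_real.
have cvg_part (f : R[i] -> R) : (forall z, `|f z|%:C <= `|z|) ->
    cvgn (series (fun k => f (u k))).
  move=> fz; apply: normed_cvg; apply: nondecreasing_is_cvgn.
    by apply: nondecreasing_series => k _ _ /=; exact: normr_ge0.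
  exists (complex.Re M) => _ [n _ <-]; rewrite -lecR MR.
  apply: le_trans (uM n); rewrite /series /= rmorph_sum.
  by apply: ler_sum => k _; exact: fz.
have /cvg_ex [a ua] := cvg_part _ (@normc_ge_Re R).
have /cvg_ex [b ub] := cvg_part _ norm_complex_ge_Im.
apply/cvg_ex; exists (a +i* b).
apply/cvgrPdist_lt => eps eps0.
have epsR : (complex.Re eps)%:C = eps by rewrite RRe_real // gtr0_real.
have e2 : 0 < complex.Re eps / 2 by rewrite divr_gt0 // -ltcR epsR.
near=> n; apply: le_lt_trans (norm_complex_le _) _.
rewrite -epsR ltcR [X in _ < X]splitr; apply: ltrD.
  have -> : complex.Re (a +i* b - series u n) = a - series (fun k => complex.Re (u k)) n.
    by rewrite -Re_series; case: (series u n).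
  by near: n; exact: cvgr_dist_lt.
have -> : complex.Im (a +i* b - series u n) = b - series (fun k => complex.Im (u k)) n.
  by rewrite -Im_series; case: (series u n).
by near: n; exact: cvgr_dist_lt.
Unshelve. all: by end_near. Qed.

Lemma norm_cexp (z : R[i]) : `|cexp z| = (expR (complex.Re z))%:C.
Proof.
rewrite /cexp normrM !normc_def /= cos2Dsin2 sqrtr1 mulr1 expr0n addr0 sqrtr_sqr.
by rewrite ger0_norm // expR_ge0.
Qed.

Lemma Re_nome_exponent (tau : R[i]) :
  complex.Re (2 * (pi : R)%:C * (0 +i* 1) * tau) = - (2 * pi * complex.Im tau).
Proof.
have -> : (2 : R[i]) = (2 : R)%:C by rewrite rmorph_nat.
by case: tau => x y; simpc.
Qed.

Lemma norm_nome (tau : R[i]) :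
  `|nome tau| = (expR (- (2 * pi * complex.Im tau)))%:C.
Proof. by rewrite /nome norm_cexp Re_nome_exponent. Qed.

End ComplexNumbers.

Theorem theorem1p7 (R : realType) (tau : R[i]) (tau_gt0 : 0 < complex.Im tau)
    (s : nat) (s_gt0 : (0 < s)%N) :
  let q := nome tau in
  crank_moment (2 * s) q
    = part_trace (@PsiT _ s)
        (fun k => eisenstein k q + ratr (bernoulli (2 * k)) / (4 * k)%:R)
  /\
  eisenstein s q
    = - (ratr (bernoulli (2 * s)) / (4 * s)%:R)
      + part_trace (@PsiV _ s) (fun k => crank_moment (2 * k) q).
Proof.
move=> q; apply: crank_moment_traces => //.
- exact: complex_abs_complete.
- by rewrite -normr_eq0 norm_nome eq_complex /= gt_eqF // expR_gt0.
(* Here Im tau > 0 enters: |q| = exp (-2 pi Im tau) < 1. *)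
- rewrite norm_nome ltcR expR_lt1 oppr_lt0 !mulr_gt0 //; exact: pi_gt0.
Qed.
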